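(* Let $k$ be a commutative ring, $G$ a finite group, and $V$ a $kG$-module that is free of finite rank as a $k$-module. Let $\mathbf{C}$ be any one of the categories $\mathbf{Cpx}(kG)$, $\mathbf{cpx}(kG)$, $\mathbf{Cpx}^*(kG)$ or $\mathbf{cpx}^*(kG)$ for $*=+,-$ or $b$. Then the subcategories $\mathcal{A}(\mathcal{K}_{V\text{-ts}}(\mathbf{C}))$ and $\mathcal{A}_{V\text{-split}}(\mathcal{K}_{V\text{-ts}}(\mathbf{C}))$ are thick subcategories of $\mathcal{K}_{V\text{-ts}}(\mathbf{C})$.
   Context: $\mathbf{Cpx}(kG)$ is the category of cochain complexes of $kG$-modules and chain maps, $\mathbf{cpx}(kG)$ the full subcategory of complexes of finitely generated $kG$-modules; superscripts $+,-,b$ denote the full subcategories of complexes bounded above, bounded below, and both. $\otimes=\otimes_k$ with diagonal $G$-action. An exact sequence $E$ of complexes is $V$-term split if in each degree $V\otimes E$ is a split sequence of $kG$-modules; let $\mathscr{E}$ be the class of such sequences in $\mathbf{C}$. The exact category $(\mathbf{C},\mathscr{E})$ is a Frobenius category, and $\mathcal{K}_{V\text{-ts}}(\mathbf{C})$ is its stable category: the objects are those of $\mathbf{C}$, the morphisms are chain maps modulo those factoring through an $\mathscr{E}$-projective object ($P$ is $\mathscr{E}$-projective if $\mathrm{Hom}(P,-)$ is exact on sequences in $\mathscr{E}$), with its usual triangulated structure: a morphism $f:X\to Y$ is completed to a triangle $X\to Y\to U\to\Omega^{-1}_{\mathscr{E}}(X)$ where $0\to X\to I\to\Omega^{-1}_{\mathscr{E}}(X)\to0$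 is in $\mathscr{E}$ with $I$ $\mathscr{E}$-injective, and $U$ is the pushout of $X\to I$ along $f$. $\mathcal{A}(\mathcal{K}_{V\text{-ts}}(\mathbf{C}))$ is the full subcategory of the complexes that are exact (zero homology). $\mathcal{A}_{V\text{-split}}(\mathcal{K}_{V\text{-ts}}(\mathbf{C}))$ is the full subcategory of the complexes that are exact and $V$-split, i.e. exact complexes $X^*$ such that $V\otimes X^*$ is contractible. A subcategory of a triangulated category is thick if it is a full triangulated subcategory (closed under the shift, and whenever two of the three objects of a triangle lie in it so does the third) and is closed under direct summands. *)

(* Defs.v *)
From HB Require Import structures.
From mathcomp Require Import all_boot all_algebra all_fingroup.
From mathcomp Require Import boolp.

Set Implicit Arguments.
Unset Strict Implicit.
Unset Printing Implicit Defensive.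

Import GRing.Theory.
Local Open Scope ring_scope.
Local Open Scope quotient_scope.
Local Notation repr := generic_quotient.repr.

(* The group algebra kG: functions G -> k under convolution.  [comPzRingType]
   does not exclude the zero ring. *)
Definition galg (k : comPzRingType) (G : finGroupType) := {ffun G -> k}.

Section GroupAlgebra.
Variables (k : comPzRingType) (G : finGroupType).
Implicit Types (a b c : galg k G) (g h : G).

HB.instance Definition _ := GRing.Lmodule.copy (galg k G) {ffun G -> k^o}.

Definition gdelta g : galg k G := [ffun h => (h == g)%:R].
Definition galg_mul a b : galg k G := [ffun x => \sum_y a y * b (y^-1 * x)%g].

Fact galg_mulA : associative galg_mul.
Proof.
move=> a b c; apply/ffunP => x; rewrite !ffunE.
under eq_bigr => y _ do rewrite ffunE mulr_sumr.
under [RHS]eq_bigr => y _ do rewrite ffunE mulr_suml.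
rewrite [RHS]exchange_big; apply: eq_bigr => z _.
rewrite [RHS](reindex_inj (mulgI z)); apply: eq_bigr => w _.
by rewrite mulrA mulKg invMg mulgA.
Qed.

Fact galg_mul1 : left_id (gdelta 1%g) galg_mul.
Proof.
move=> a; apply/ffunP => x; rewrite ffunE (bigD1 1%g) //= ffunE eqxx mul1r.
rewrite invg1 mul1g big1 ?addr0 // => y ny.
by rewrite ffunE (negPf ny) mul0r.
Qed.

Fact galg_mulr1 : right_id (gdelta 1%g) galg_mul.
Proof.
move=> a; apply/ffunP => x; rewrite ffunE (bigD1 x) //= ffunE mulVg eqxx mulr1.
rewrite big1 ?addr0 // => y ny; rewrite ffunE -eq_invg_mul invgK (negPf ny).
by rewrite mulr0.
Qed.

Fact galg_mulDl : left_distributive galg_mul +%R.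
Proof.
move=> a b c; apply/ffunP => x; rewrite !ffunE -big_split.
by apply: eq_bigr => y _; rewrite ffunE mulrDl.
Qed.

Fact galg_mulDr : right_distributive galg_mul +%R.
Proof.
move=> a b c; apply/ffunP => x; rewrite !ffunE -big_split.
by apply: eq_bigr => y _; rewrite ffunE mulrDr.
Qed.

HB.instance Definition _ := GRing.Zmodule_isPzRing.Build (galg k G)
  galg_mulA galg_mul1 galg_mulr1 galg_mulDl galg_mulDr.

Lemma galg_mulE a b x : (a * b) x = \sum_y a y * b (y^-1 * x)%g.
Proof. by rewrite ffunE. Qed.

Lemma galg_scaleE (c : k) a x : (c *: a) x = c * a x.
Proof. by rewrite ffunE. Qed.

Lemma gdelta1 : gdelta 1%g = 1. Proof. by []. Qed.

Lemma gdeltaM g h : gdelta (g * h)%g = gdelta g * gdelta h.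
Proof.
apply/ffunP => x; rewrite galg_mulE (bigD1 g) //= !ffunE eqxx mul1r big1.
  by rewrite addr0 (can2_eq (mulKVg g) (mulKg g)).
by move=> y ny; rewrite ffunE (negPf ny) mul0r.
Qed.

Lemma galg_scaleAl (c : k) a b : c *: (a * b) = (c *: a) * b.
Proof.
apply/ffunP => x; rewrite galg_scaleE !galg_mulE mulr_sumr.
by apply: eq_bigr => y _; rewrite galg_scaleE mulrA.
Qed.

Lemma galg_scaleAr (c : k) a b : c *: (a * b) = a * (c *: b).
Proof.
apply/ffunP => x; rewrite galg_scaleE !galg_mulE mulr_sumr.
by apply: eq_bigr => y _; rewrite galg_scaleE mulrCA.
Qed.

End GroupAlgebra.

(* A kG-module is an [lmodType (galg k G)]; its underlying k-module structure: *)
Definition kscale (k : comPzRingType) (G : finGroupType)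
    (M : lmodType (galg k G)) (c : k) (m : M) : M :=
  (c *: (1 : galg k G)) *: m.

Definition gact (k : comPzRingType) (G : finGroupType)
    (M : lmodType (galg k G)) (g : G) (m : M) : M := gdelta k g *: m.

Definition free_finite_rank (k : comPzRingType) (G : finGroupType)
    (V : lmodType (galg k G)) : Prop :=
  exists (n : nat) (e : 'I_n -> V),
    forall v : V, exists! c : {ffun 'I_n -> k}, v = \sum_i kscale (c i) (e i).

Definition fin_generated (R : pzRingType) (M : lmodType R) : Prop :=
  exists (n : nat) (e : 'I_n -> M),
    forall m : M, exists c : 'I_n -> R, m = \sum_i c i *: e i.

Section KScale.
Variables (k : comPzRingType) (G : finGroupType) (M N : lmodType (galg k G)).
Implicit Types (c d : k) (m n : M) (g h : G) (a b : galg k G).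

Lemma kscaleA c d m : kscale c (kscale d m) = kscale (c * d) m.
Proof. by rewrite /kscale scalerA -galg_scaleAl mul1r scalerA. Qed.
Lemma kscale1 m : kscale 1 m = m.
Proof. by rewrite /kscale !scale1r. Qed.
Lemma kscaleDr c m n : kscale c (m + n) = kscale c m + kscale c n.
Proof. exact: scalerDr. Qed.
Lemma kscaleDl c d m : kscale (c + d) m = kscale c m + kscale d m.
Proof. by rewrite /kscale !scalerDl. Qed.
Lemma kscale0 m : kscale 0 m = 0.
Proof. by rewrite /kscale !scale0r. Qed.
Lemma kscaler0 c : kscale c (0 : M) = 0.
Proof. exact: scaler0. Qed.
Lemma gact1 m : gact 1%g m = m.
Proof. by rewrite /gact gdelta1 scale1r. Qed.
Lemma gactM g h m : gact (g * h)%g m = gact g (gact h m).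
Proof. by rewrite /gact gdeltaM scalerA. Qed.
Lemma gactD g m n : gact g (m + n) = gact g m + gact g n.
Proof. exact: scalerDr. Qed.
Lemma gactZ g c m : gact g (kscale c m) = kscale c (gact g m).
Proof.
by rewrite /gact /kscale !scalerA -galg_scaleAr -galg_scaleAl mul1r mulr1.
Qed.

Lemma galg_scale_sum a m : a *: m = \sum_g kscale (a g) (gact g m).
Proof.
rewrite {1}(_ : a = \sum_g a g *: gdelta k g).
  rewrite scaler_suml; apply: eq_bigr => g _.
  by rewrite /kscale /gact scalerA -galg_scaleAl mul1r.
apply/ffunP => x; rewrite sum_ffunE (bigD1 x) //= galg_scaleE ffunE eqxx mulr1.
by rewrite big1 ?addr0 // => y ny; rewrite galg_scaleE ffunE eq_sym (negPf ny) mulr0.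
Qed.

Lemma linear_kscale (f : {linear M -> N}) c m : f (kscale c m) = kscale c (f m).
Proof. exact: linearZ_LR. Qed.
Lemma linear_gact (f : {linear M -> N}) g m : f (gact g m) = gact g (f m).
Proof. exact: linearZ_LR. Qed.

End KScale.

(* V ⊗_k M by generators and relations: a sequence of pairs stands for the
   corresponding sum of pure tensors. *)
Section Tensor.
Variables (k : comPzRingType) (G : finGroupType) (V M : lmodType (galg k G)).
Implicit Types (s t u : seq (V * M)).

Inductive tens_rel : seq (V * M) -> seq (V * M) -> Prop :=
| tens_refl s : tens_rel s s
| tens_sym s t : tens_rel s t -> tens_rel t s
| tens_trans s t u : tens_rel s t -> tens_rel t u -> tens_rel s u
| tens_cat s s' t t' :
    tens_rel s s' -> tens_rel t t' -> tens_rel (s ++ t) (s' ++ t')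
| tens_catC s t : tens_rel (s ++ t) (t ++ s)
| tens_0 : tens_rel [:: (0, 0)] [::]
| tens_addl v v' m : tens_rel [:: (v + v', m)] [:: (v, m); (v', m)]
| tens_addr v m m' : tens_rel [:: (v, m + m')] [:: (v, m); (v, m')]
| tens_scale c v m : tens_rel [:: (kscale c v, m)] [:: (v, kscale c m)].

Definition tens_relb s t : bool := `[< tens_rel s t >].

Fact tens_relb_equiv : equiv_class_of tens_relb.
Proof.
split=> [s|s t|t s u].
- exact/asboolP/tens_refl.
- by apply/asboolP/asboolP; apply: tens_sym.
- move=> /asboolP st /asboolP tu; apply/asboolP; exact: tens_trans st tu.
Qed.
Canonical tens_equiv := EquivRelPack tens_relb_equiv.

Definition tensor := {eq_quot tens_relb}.
HB.instance Definition _ := Choice.on tensor.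
HB.instance Definition _ := EqQuotient.on tensor.

Definition tclass s : tensor := \pi s.
Definition tens (v : V) (m : M) : tensor := tclass [:: (v, m)].

Lemma tclassP s t : tclass s = tclass t <-> tens_rel s t.
Proof. by split=> [/eqmodP/asboolP|?] //; apply/eqmodP/asboolP. Qed.

Lemma tclassK (x : tensor) : tclass (repr x) = x.
Proof. exact: reprK. Qed.

Lemma repr_tclass s : tens_rel (repr (tclass s)) s.
Proof. by apply/tclassP; rewrite tclassK. Qed.

Definition tens_neg s : seq (V * M) := [seq (- p.1, p.2) | p <- s].

Definition tensor_add (x y : tensor) := tclass (repr x ++ repr y).
Definition tensor_opp (x : tensor) := tclass (tens_neg (repr x)).

Lemma tensor_add_class s t : tensor_add (tclass s) (tclass t) = tclass (s ++ t).
Proof. by apply/tclassP; apply: tens_cat; apply: repr_tclass. Qed.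

Lemma tens_0l m : tens_rel [:: (0, m)] [::].
Proof.
apply: tens_trans tens_0; rewrite -{1}(kscale0 (0 : V)).
by apply: tens_trans (tens_scale _ _ _) _; rewrite kscale0; apply: tens_refl.
Qed.

Lemma tens_negP s : tens_rel (tens_neg s ++ s) [::].
Proof.
elim: s => [|[v m] s IH] /=; first exact: tens_refl.
rewrite -[(- v, m) :: _]cat1s -[(v, m) :: s]cat1s.
apply: tens_trans (tens_cat (tens_refl _) (tens_catC _ _)) _.
rewrite -catA [X in tens_rel X _]catA.
apply: (@tens_trans _ ([::] ++ [::])); last exact: tens_refl.
apply: tens_cat; last exact: tens_trans (tens_catC _ _) IH.
apply: tens_trans (tens_0l m); apply: tens_sym; rewrite -(addNr v).
exact: tens_addl.
Qed.

Fact tensor_addA : associative tensor_add.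
Proof.
move=> x y z; rewrite -(tclassK x) -(tclassK y) -(tclassK z).
by rewrite !tensor_add_class catA.
Qed.

Fact tensor_addC : commutative tensor_add.
Proof. by move=> x y; apply/tclassP/tens_catC. Qed.

Fact tensor_add0 : left_id (tclass [::]) tensor_add.
Proof. by move=> x; rewrite -(tclassK x) tensor_add_class. Qed.

Fact tensor_addN : left_inverse (tclass [::]) tensor_opp tensor_add.
Proof.
move=> x; rewrite /tensor_opp -[X in tensor_add _ X](tclassK x) tensor_add_class.
exact/tclassP/tens_negP.
Qed.

HB.instance Definition _ := GRing.isZmodule.Build tensor
  tensor_addA tensor_addC tensor_add0 tensor_addN.

Lemma tclass_nil : tclass [::] = 0. Proof. by []. Qed.

Lemma tclass_cat s t : tclass (s ++ t) = tclass s + tclass t.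
Proof. by rewrite -tensor_add_class. Qed.

Lemma tclassE s : tclass s = \sum_(p <- s) tens p.1 p.2.
Proof.
elim: s => [|[v m] s IH]; first by rewrite big_nil.
by rewrite big_cons -IH -cat1s tclass_cat.
Qed.

Lemma tensDl v v' m : tens (v + v') m = tens v m + tens v' m.
Proof. by rewrite -tclass_cat; apply/tclassP/tens_addl. Qed.

Lemma tensDr v m m' : tens v (m + m') = tens v m + tens v m'.
Proof. by rewrite -tclass_cat; apply/tclassP/tens_addr. Qed.

Lemma tensZ c v m : tens (kscale c v) m = tens v (kscale c m).
Proof. exact/tclassP/tens_scale. Qed.

Lemma tens0l m : tens 0 m = 0.
Proof. exact/tclassP/tens_0l. Qed.

Lemma tens0r v : tens v 0 = 0.
Proof. by rewrite -(kscale0 (0 : M)) -tensZ kscale0 tens0l. Qed.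

Lemma tensor_ind (P : tensor -> Prop) :
  P 0 -> (forall x y, P x -> P y -> P (x + y)) -> (forall v m, P (tens v m)) ->
  forall x, P x.
Proof.
move=> P0 PD Pt x; rewrite -(tclassK x) tclassE.
by apply: (big_ind P) => // p _; apply: Pt.
Qed.

Definition balanced (T : zmodType) (phi : V -> M -> T) :=
  [/\ forall v v' m, phi (v + v') m = phi v m + phi v' m,
      forall v m m', phi v (m + m') = phi v m + phi v m' &
      forall c v m, phi (kscale c v) m = phi v (kscale c m)].

Definition tlift (T : zmodType) (phi : V -> M -> T) (x : tensor) : T :=
  \sum_(p <- repr x) phi p.1 p.2.

Section Lift.
Variables (T : zmodType) (phi : V -> M -> T) (bal : balanced phi).

Lemma tlift_class s : tlift phi (tclass s) = \sum_(p <- s) phi p.1 p.2.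
Proof.
case: bal => addl addr scal.
suff sumE t u : tens_rel t u ->
    \sum_(p <- t) phi p.1 p.2 = \sum_(p <- u) phi p.1 p.2.
  exact/sumE/repr_tclass.
elim=> {s t u} //=.
- by move=> s t u _ -> _ ->.
- by move=> s s' t t' _ e1 _ e2; rewrite !big_cat /= e1 e2.
- by move=> s t; rewrite !big_cat /= addrC.
- rewrite big_seq1 big_nil /=; apply: (addIr (phi 0 0)).
  by rewrite -addl addr0 add0r.
- by move=> v v' m; rewrite !big_cons !big_nil !addr0 /= addl.
- by move=> v m m'; rewrite !big_cons !big_nil !addr0 /= addr.
- by move=> c v m; rewrite !big_seq1 /= scal.
Qed.

Lemma tlift_tens v m : tlift phi (tens v m) = phi v m.
Proof. by rewrite tlift_class big_seq1. Qed.

Lemma tliftD x y : tlift phi (x + y) = tlift phi x + tlift phi y.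
Proof.
by rewrite -(tclassK x) -(tclassK y) -tclass_cat !tlift_class big_cat.
Qed.

Lemma tlift0 : tlift phi 0 = 0.
Proof. by rewrite -tclass_nil tlift_class big_nil. Qed.

Lemma tlift_sum (I : Type) (r : seq I) (F : I -> tensor) :
  tlift phi (\sum_(i <- r) F i) = \sum_(i <- r) tlift phi (F i).
Proof. exact: (big_morph _ tliftD tlift0). Qed.

End Lift.

(* The diagonal action, extended k-linearly from G to kG. *)
Definition diag (a : galg k G) (v : V) (m : M) : tensor :=
  \sum_g tens (kscale (a g) (gact g v)) (gact g m).

Fact diag_balanced a : balanced (diag a).
Proof.
split=> [v v' m|v m m'|c v m]; rewrite /diag -?big_split;
  apply: eq_bigr => g _ /=.
- by rewrite gactD kscaleDr tensDl.
- by rewrite gactD tensDr.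
- by rewrite !gactZ kscaleA mulrC -kscaleA tensZ.
Qed.

Definition tensor_scale (a : galg k G) : tensor -> tensor := tlift (diag a).

Lemma tensor_scale_tens a v m : tensor_scale a (tens v m) = diag a v m.
Proof. exact: tlift_tens (diag_balanced a) _ _. Qed.

Fact tensor_scaleDr : right_distributive tensor_scale +%R.
Proof. by move=> a x y; apply: tliftD (diag_balanced a) _ _. Qed.

Lemma tensor_scale0 a : tensor_scale a 0 = 0.
Proof. exact: tlift0 (diag_balanced a). Qed.

Fact tensor_scaleDl x : {morph tensor_scale^~ x : a b / a + b}.
Proof.
move=> a b /=; elim/tensor_ind: x => [|x y IHx IHy|v m].
- by rewrite !tensor_scale0 addr0.
- by rewrite !tensor_scaleDr IHx IHy addrACA.
- rewrite !tensor_scale_tens /diag -big_split; apply: eq_bigr => g _ /=.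
  by rewrite ffunE kscaleDl tensDl.
Qed.

Fact tensor_scale1 : left_id 1 tensor_scale.
Proof.
elim/tensor_ind=> [|x y IHx IHy|v m].
- exact: tensor_scale0.
- by rewrite tensor_scaleDr IHx IHy.
- rewrite tensor_scale_tens /diag (bigD1 1%g) //= ffunE eqxx kscale1 !gact1.
  by rewrite big1 ?addr0 // => g ng; rewrite ffunE (negPf ng) kscale0 tens0l.
Qed.

Lemma tens_suml (I : Type) (r : seq I) (F : I -> V) m :
  tens (\sum_(i <- r) F i) m = \sum_(i <- r) tens (F i) m.
Proof. exact: (big_morph (tens^~ m) (fun v v' => tensDl v v' m) (tens0l m)). Qed.

Lemma kscale_suml (I : Type) (r : seq I) (c : I -> k) (v : V) :
  kscale (\sum_(i <- r) c i) v = \sum_(i <- r) kscale (c i) v.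
Proof.
exact: (big_morph (fun c => kscale c v) (fun c d => kscaleDl c d v) (kscale0 v)).
Qed.

Fact tensor_scaleA a b x :
  tensor_scale a (tensor_scale b x) = tensor_scale (a * b) x.
Proof.
elim/tensor_ind: x => [|x y IHx IHy|v m].
- by rewrite !tensor_scale0.
- by rewrite !tensor_scaleDr IHx IHy.
- rewrite !tensor_scale_tens {2}/diag /tensor_scale.
  under [RHS]eq_bigr => x _ do rewrite galg_mulE kscale_suml tens_suml.
  rewrite [LHS](tlift_sum (diag_balanced a)) [RHS]exchange_big /=.
  under eq_bigr => h _ do
    rewrite [tlift _ _](tlift_tens (diag_balanced a)) /diag.
  rewrite exchange_big /=; apply: eq_bigr => g _.
  rewrite [RHS](reindex_inj (mulgI g)); apply: eq_bigr => h _ /=.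
  by rewrite mulKg !gactM gactZ kscaleA.
Qed.

HB.instance Definition _ := GRing.Zmodule_isLmodule.Build (galg k G) tensor
  tensor_scaleA tensor_scale1 tensor_scaleDr tensor_scaleDl.

Lemma tens_diagE a v m :
  a *: tens v m = \sum_g tens (kscale (a g) (gact g v)) (gact g m).
Proof. exact: tensor_scale_tens. Qed.

Lemma gact_tens g v m : gact g (tens v m) = tens (gact g v) (gact g m).
Proof.
rewrite [LHS]tens_diagE (bigD1 g) //= ffunE eqxx kscale1 big1 ?addr0 //.
by move=> h nh; rewrite ffunE (negPf nh) kscale0 tens0l.
Qed.

End Tensor.

Section TensorMap.
Variables (k : comPzRingType) (G : finGroupType) (V M N : lmodType (galg k G)).
Variable f : {linear M -> N}.

(* V ⊗ f *)
Definition tensor_map : tensor V M -> tensor V N :=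
  tlift (fun v m => tens v (f m)).

Fact tensor_map_balanced : balanced (fun (v : V) m => tens v (f m)).
Proof.
split=> [v v' m|v m m'|c v m]; first exact: tensDl.
- by rewrite linearD tensDr.
- by rewrite linear_kscale tensZ.
Qed.

Lemma tensor_map_tens v m : tensor_map (tens v m) = tens v (f m).
Proof. exact: tlift_tens tensor_map_balanced _ _. Qed.

Fact tensor_map_linear : linear tensor_map.
Proof.
move=> a x y; rewrite [LHS](tliftD tensor_map_balanced) -!/(tensor_map _).
congr (_ + _); elim/tensor_ind: x => [|x z IHx IHz|v m].
- by rewrite scaler0 [tensor_map _](tlift0 tensor_map_balanced) scaler0.
- rewrite scalerDr ![tensor_map (_ + _)](tliftD tensor_map_balanced).
  by rewrite -!/(tensor_map _) IHx IHz scalerDr.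
- rewrite tensor_map_tens !tens_diagE.
  rewrite [LHS](tlift_sum tensor_map_balanced); apply: eq_bigr => g _.
  by rewrite -!/(tensor_map _) tensor_map_tens linear_gact.
Qed.

HB.instance Definition _ := GRing.isLinear.Build (galg k G)
  (tensor V M) (tensor V N) _ tensor_map tensor_map_linear.

End TensorMap.
Arguments tensor_map {k G} V {M N} f.

Lemma tensor_map0 (k : comPzRingType) (G : finGroupType)
    (V M N : lmodType (galg k G)) (f : {linear M -> N}) :
  (forall m, f m = 0) -> forall x, tensor_map V f x = 0.
Proof.
move=> f0; elim/tensor_ind=> [|x y IHx IHy|v m]; first exact: linear0.
  by rewrite linearD /= IHx IHy addr0.
by rewrite tensor_map_tens f0 tens0r.
Qed.

Lemma tensor_map_comp (k : comPzRingType) (G : finGroupType)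
    (V M N P : lmodType (galg k G)) (f : {linear M -> N}) (g : {linear N -> P}) x :
  tensor_map V (g \o f) x = tensor_map V g (tensor_map V f x).
Proof.
elim/tensor_ind: x => [|x y IHx IHy|v m]; first by rewrite !linear0.
  by rewrite !linearD /= IHx IHy.
by rewrite !tensor_map_tens.
Qed.

Section Complexes.
Variable R : pzRingType.

Record cochain := Cochain {
  cterm :> int -> lmodType R;
  cdiff : forall n, {linear cterm n -> cterm (n + 1)};
  cdiff0 : forall n x, cdiff (n + 1) (cdiff n x) = 0 }.

Record cmap (X Y : cochain) := CMap {
  cmor :> forall n, {linear X n -> Y n};
  cmorP : forall n x, cmor (n + 1) (cdiff X n x) = cdiff Y n (cmor n x) }.

Definition ceq (X Y : cochain) (f g : cmap X Y) := forall n x, f n x = g n x.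

Definition cid (X : cochain) : cmap X X.
Proof. by exists (fun n => idfun : {linear X n -> X n}). Defined.

Definition ccomp (X Y Z : cochain) (g : cmap Y Z) (f : cmap X Y) : cmap X Z.
Proof.
exists (fun n => g n \o f n : {linear X n -> Z n}).
by abstract by move=> n x /=; rewrite !cmorP.
Defined.

Definition czero (X Y : cochain) : cmap X Y.
Proof.
exists (fun n => \0 : {linear X n -> Y n}).
by abstract by move=> n x /=; rewrite linear0.
Defined.

Definition cadd (X Y : cochain) (f g : cmap X Y) : cmap X Y.
Proof.
exists (fun n => f n \+ g n : {linear X n -> Y n}).
by abstract by move=> n x /=; rewrite !cmorP linearD.
Defined.

(* Degrees are written n + 1, which runs through all of int. *)
Definition exact_cochain (X : cochain) : Prop :=
  forall n (x : X (n + 1)), cdiff X (n + 1) x = 0 -> exists y, cdiff X n y = x.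

Definition contractible (X : cochain) : Prop :=
  exists h : forall n, {linear X (n + 1) -> X n},
    forall n (x : X (n + 1)),
      x = cdiff X n (h n x) + h (n + 1) (cdiff X (n + 1) x).

Definition is_bounded_above (X : cochain) : Prop :=
  exists N : int, forall n, (N < n)%R -> forall x : X n, x = 0.

Definition is_bounded_below (X : cochain) : Prop :=
  exists N : int, forall n, (n < N)%R -> forall x : X n, x = 0.

Definition short_exact (A B C : lmodType R)
    (i : {linear A -> B}) (p : {linear B -> C}) : Prop :=
  [/\ injective i, forall b, p b = 0 <-> exists a, b = i a &
      forall c, exists b, p b = c].

Definition split_exact (A B C : lmodType R)
    (i : {linear A -> B}) (p : {linear B -> C}) : Prop :=
  short_exact i p /\ exists s : {linear C -> B}, cancel s p.

Definition short_exact_cochain (X Y Z : cochain)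
    (i : cmap X Y) (p : cmap Y Z) : Prop :=
  forall n, short_exact (i n) (p n).

End Complexes.

Infix "=c" := ceq (at level 70).
Infix "\oc" := ccomp (at level 50).
Infix "+c" := cadd (at level 50).

Variant bounds := Unbounded | BoundedAbove | BoundedBelow | Bounded.

(* The eight categories: Cpx and cpx, with no superscript or with +, -, b. *)
Variant cpx_cat := Cpx of bounds | cpx of bounds.

Definition in_bounds (R : pzRingType) (b : bounds) (X : cochain R) : Prop :=
  match b with
  | Unbounded => True
  | BoundedAbove => is_bounded_above X
  | BoundedBelow => is_bounded_below X
  | Bounded => is_bounded_above X /\ is_bounded_below X
  end.

Definition in_cat (R : pzRingType) (C : cpx_cat) (X : cochain R) : Prop :=
  match C with
  | Cpx b => in_bounds b X
  | cpx b => (forall n, fin_generated (X n)) /\ in_bounds b X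
  end.

Record cob (R : pzRingType) (C : cpx_cat) := Cob {
  cob_val :> cochain R;
  cobP : in_cat C cob_val }.

Section TensorComplex.
Variables (k : comPzRingType) (G : finGroupType) (V : lmodType (galg k G)).

Definition tensor_cochain (X : cochain (galg k G)) : cochain (galg k G).
Proof.
exists (fun n => tensor V (X n) : lmodType (galg k G))
       (fun n => tensor_map V (cdiff X n) : {linear _ -> _}).
by abstract by move=> n x /=; rewrite -tensor_map_comp; apply: tensor_map0 => m;
  apply: cdiff0.
Defined.

Definition term_split (X Y Z : cochain (galg k G))
    (i : cmap X Y) (p : cmap Y Z) : Prop :=
  short_exact_cochain i p /\
  forall n, split_exact (tensor_map V (i n)) (tensor_map V (p n)).

End TensorComplex.

(* The exact category (C, E), its stable category K_{V-ts}(C), triangles and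
   thick subcategories.  The objects of K_{V-ts}(C) are those of C; its morphisms
   are represented by chain maps, and [stable_eq] is their equality. *)
Section Stable.
Variables (k : comPzRingType) (G : finGroupType) (V : lmodType (galg k G)).
Variable C : cpx_cat.
Local Notation ob := (cob (galg k G) C).

Definition E_projective (P : ob) : Prop :=
  forall (X Y Z : ob) (i : cmap X Y) (p : cmap Y Z), term_split V i p ->
  [/\ forall u u' : cmap P X, i \oc u =c i \oc u' -> u =c u',
      forall v : cmap P Y, p \oc v =c czero P Z <->
                           exists u : cmap P X, v =c i \oc u &
      forall w : cmap P Z, exists v : cmap P Y, p \oc v =c w].

Definition E_injective (I : ob) : Prop :=
  forall (X Y Z : ob) (i : cmap X Y) (p : cmap Y Z), term_split V i p ->
  [/\ forall w w' : cmap Z I, w \oc p =c w' \oc p -> w =c w',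
      forall v : cmap Y I, v \oc i =c czero X I <->
                           exists w : cmap Z I, v =c w \oc p &
      forall u : cmap X I, exists v : cmap Y I, v \oc i =c u].

Definition stable_eq (X Y : ob) (f g : cmap X Y) : Prop :=
  exists (P : ob) (a : cmap X P) (b : cmap P Y),
    E_projective P /\ f =c g +c (b \oc a).

Definition stable_iso (X Y : ob) (f : cmap X Y) : Prop :=
  exists g : cmap Y X, stable_eq (g \oc f) (cid X) /\ stable_eq (f \oc g) (cid Y).

(* 0 -> X -> I -> W -> 0 in E with I E-injective; W is an Omega^{-1}(X).
   No choice of I is fixed: what follows quantifies over all of them. *)
Record cosyzygy (X : ob) := Cosyzygy {
  cs_inj : ob;
  cs_ob : ob;
  cs_i : cmap X cs_inj;
  cs_p : cmap cs_inj cs_ob;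
  cs_split : term_split V cs_i cs_p;
  cs_injective : E_injective cs_inj }.

(* b represents Omega^{-1}(a). *)
Definition shift_map (X X' : ob) (w : cosyzygy X) (w' : cosyzygy X')
    (a : cmap X X') (b : cmap (cs_ob w) (cs_ob w')) : Prop :=
  exists c : cmap (cs_inj w) (cs_inj w'),
    c \oc cs_i w =c cs_i w' \oc a /\ b \oc cs_p w =c cs_p w' \oc c.

Definition is_pushout (X Y I U : ob)
    (f : cmap X Y) (i : cmap X I) (g : cmap Y U) (j : cmap I U) : Prop :=
  g \oc f =c j \oc i /\
  forall (T : ob) (a : cmap Y T) (b : cmap I T), a \oc f =c b \oc i ->
    exists c : cmap U T,
      [/\ c \oc g =c a, c \oc j =c b &
          forall c' : cmap U T, c' \oc g =c a -> c' \oc j =c b -> c' =c c].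

Definition standard_triangle (X Y U : ob) (w : cosyzygy X)
    (f : cmap X Y) (g : cmap Y U) (h : cmap U (cs_ob w)) : Prop :=
  exists j : cmap (cs_inj w) U,
    [/\ is_pushout f (cs_i w) g j, h \oc g =c czero Y (cs_ob w) &
        h \oc j =c cs_p w].

(* X -> Y -> Z -> Omega^{-1}(X) isomorphic in K_{V-ts}(C) to a standard triangle *)
Definition triangle (X Y Z : ob) (w : cosyzygy X)
    (f : cmap X Y) (g : cmap Y Z) (h : cmap Z (cs_ob w)) : Prop :=
  exists (X' Y' Z' : ob) (w' : cosyzygy X')
         (f' : cmap X' Y') (g' : cmap Y' Z') (h' : cmap Z' (cs_ob w'))
         (a : cmap X X') (b : cmap Y Y') (c : cmap Z Z')
         (sa : cmap (cs_ob w) (cs_ob w')),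
  [/\ standard_triangle f' g' h',
      [/\ stable_iso a, stable_iso b, stable_iso c & shift_map a sa],
      stable_eq (b \oc f) (f' \oc a),
      stable_eq (c \oc g) (g' \oc b) &
      stable_eq (sa \oc h) (h' \oc c)].

(* X is a direct sum of Y and Y' in K_{V-ts}(C). *)
Definition stable_biproduct (X Y Y' : ob) : Prop :=
  exists (i : cmap Y X) (p : cmap X Y) (i' : cmap Y' X) (p' : cmap X Y'),
  [/\ stable_eq (p \oc i) (cid Y), stable_eq (p' \oc i') (cid Y'),
      stable_eq (p \oc i') (czero Y' Y), stable_eq (p' \oc i) (czero Y Y') &
      stable_eq ((i \oc p) +c (i' \oc p')) (cid X)].

Definition stable_zero (X : ob) : Prop := stable_eq (cid X) (czero X X).

(* S is the class of objects of a full subcategory of K_{V-ts}(C). *)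
Definition thick (S : ob -> Prop) : Prop :=
  [/\ forall X : ob, stable_zero X -> S X,
      forall (X : ob) (w : cosyzygy X), S X <-> S (cs_ob w),
      forall (X Y Z : ob) (w : cosyzygy X)
             (f : cmap X Y) (g : cmap Y Z) (h : cmap Z (cs_ob w)),
        triangle f g h ->
        [/\ S X -> S Y -> S Z, S X -> S Z -> S Y & S Y -> S Z -> S X] &
      forall X Y Y' : ob, stable_biproduct X Y Y' -> S X -> S Y].

Definition A_exact (X : ob) : Prop := exact_cochain X.

Definition A_Vsplit (X : ob) : Prop :=
  exact_cochain X /\ contractible (tensor_cochain V X).

End Stable.

(* Main.v *)
(* Testing against the termwise split sequences P[-1] -> cone -> P and
   I -> cone -> I[1] shows that E-projectives and E-injectives are contractible, so
   stably equal chain maps are homotopic.  Exactness and contractibility of V ⊗ X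
   are both invariant under homotopy retracts and satisfy two-out-of-three on V-term
   split sequences.  Any such property is thick: for a standard triangle apply
   two-out-of-three to X -> Y ⊕ I -> U, where Y ⊕ I may be replaced by Y.

   Contractibility is tested degree by degree: it suffices that each
   X^n -> Z^(n+1) is split by a linear map defined on all of X^(n+1), so the diagram
   chases for exactness carry over with linear choices. *)
From HB Require Import structures.
From mathcomp Require Import all_boot all_algebra all_fingroup.
From mathcomp Require Import boolp ring_quotient zify.
Require Import Defs.

Set Implicit Arguments.
Unset Strict Implicit.
Unset Printing Implicit Defensive.

Import GRing.Theory.
Local Open Scope ring_scope.
Local Open Scope quotient_scope.

Lemma linear_fun_exists (R : pzRingType) (M N : lmodType R) (f : M -> N) :
  linear f -> exists F : {linear M -> N}, F =1 f.
Proof.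
move=> lf; pose F := HB.pack_for {linear M -> N} f
  (GRing.isLinear.Build _ _ _ _ f lf).
by exists F.
Qed.

Lemma int_succ (n : int) : exists m, n = m + 1.
Proof. by exists (n - 1); rewrite subrK. Qed.

(** * Homotopies, exactness and contractibility, degree by degree *)

Section Contraction.
Variable R : pzRingType.
Implicit Types X Y Z : cochain R.

Definition homotopic X Y (f g : cmap X Y) : Prop :=
  exists h : forall n, {linear X (n + 1) -> Y n},
    forall n (x : X (n + 1)),
      f _ x - g _ x = cdiff Y n (h n x) + h (n + 1) (cdiff X (n + 1) x).

(** [u] is a bare function, so that a single condition expresses exactness, and contractibility once
    [u] is required to be linear. *)
Definition splits_cycles X n (u : X (n + 1) -> X n) : Prop :=
  forall x, cdiff X (n + 1) x = 0 -> cdiff X n (u x) = x.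

Lemma exactP X : exact_cochain X <->
  forall n, exists u : X (n + 1) -> X n, splits_cycles u.
Proof.
split=> [ex n|sp n x dx]; last by have [u uP] := sp n; exists (u x); apply: uP.
have /choice[u uP] : forall x : X (n + 1), exists y,
    cdiff X (n + 1) x = 0 -> cdiff X n y = x.
  move=> x; case: (pselect (cdiff X (n + 1) x = 0)) => [/ex[y <-]|nx].
    by exists y.
  (* Off the cycles the value is arbitrary. *)
  by exists 0.
by exists u => x; apply: uP.
Qed.

Lemma contractibleP X : contractible X <->
  forall n, exists u : {linear X (n + 1) -> X n}, splits_cycles u.
Proof.
split=> [[h hP] n|sp].
  by exists (h n) => x dx; rewrite [RHS]hP dx linear0 addr0.
pose u n : {linear X (n + 1) -> X n} := projT1 (boolp.cid (sp n)).
have uP n : splits_cycles (u n) by rewrite /u; case: boolp.cid.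
(* As [d u d = d], the map [idfun \- u d] projects onto the cycles, so [u] splits its values. The
   term [u (d x)] removed here is restored by the homotopy at [d x], because [d (d x) = 0]. *)
exists (fun n => u n \o (idfun \- (u (n + 1) \o cdiff X (n + 1)))
  : {linear _ -> _}) => n x /=.
rewrite cdiff0 [u (n + 1 + 1) 0]linear0 subr0 uP ?subrK // linearB /=.
by rewrite [cdiff X _ (u _ _)]uP ?subrr // cdiff0.
Qed.

Lemma exact_contractible X : contractible X -> exact_cochain X.
Proof. by move=> /contractibleP sp; apply/exactP => n; have [u] := sp n; exists u. Qed.

(** For a cycle [y], the boundary of [p (u (i y))] is [p (i y)], which exceeds [y] by the boundary
    of [h y]. *)
Lemma splits_cycles_retract X Y (i : cmap Y X) (p : cmap X Y)
    (h : forall n, {linear Y (n + 1) -> Y n}) n (u : X (n + 1) -> X n) :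
  (forall n (y : Y (n + 1)),
    p _ (i _ y) - y = cdiff Y n (h n y) + h (n + 1) (cdiff Y (n + 1) y)) ->
  splits_cycles u -> splits_cycles (fun y => p n (u (i _ y)) - h n y).
Proof.
move=> hP uP y dy.
have di : cdiff X (n + 1) (i _ y) = 0 by rewrite -cmorP dy linear0.
rewrite linearB /= -cmorP uP //.
have := hP n y; rewrite dy linear0 addr0 => <-.
exact: subKr.
Qed.

Lemma exact_retract X Y (i : cmap Y X) (p : cmap X Y) :
  homotopic (p \oc i) (cid Y) -> exact_cochain X -> exact_cochain Y.
Proof.
move=> [h hP] /exactP sp; apply/exactP => n; have [u uP] := sp n.
by eexists; apply: (splits_cycles_retract hP uP).
Qed.

Lemma contractible_retract X Y (i : cmap Y X) (p : cmap X Y) :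
  homotopic (p \oc i) (cid Y) -> contractible X -> contractible Y.
Proof.
move=> [h hP] /contractibleP sp; apply/contractibleP => n; have [u uP] := sp n.
exists (p n \o u \o i (n + 1) \- h n : {linear _ -> _}).
exact: (splits_cycles_retract hP uP).
Qed.

Lemma ceq_homotopic X Y (f g : cmap X Y) : f =c g -> homotopic f g.
Proof.
move=> fg; exists (fun n => \0 : {linear X (n + 1) -> Y n}) => n x /=.
by rewrite fg subrr linear0 addr0.
Qed.

(** * Two out of three in short exact sequences *)

Section TwoOfThree.
Variables (A B C : cochain R) (i : cmap A B) (p : cmap B C).
Hypothesis ip : short_exact_cochain i p.
Variables (r : forall n, B n -> A n) (s : forall n, C n -> B n).
Hypothesis rK : forall n b, p n b = 0 -> i n (r b) = b.
Hypothesis sK : forall n, cancel (@s n) (p n).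

Let i_inj n : injective (i n). Proof. by case: (ip n). Qed.
Let pi0 n a : p n (i n a) = 0.
Proof. by case: (ip n) => _ ker _; apply/ker; exists a. Qed.

(** The lift [s c] need not be a cycle, but its boundary is the image of a cycle of [A]. Subtracting
    an element of [A] with that boundary makes it a cycle, and [uB] applies. *)
Lemma splits_cycles_quo n (uA : A (n + 1 + 1) -> A (n + 1)) (uB : B (n + 1) -> B n) :
  splits_cycles uA -> splits_cycles uB ->
  splits_cycles (fun c => p n (uB (s c - i _ (uA (r (cdiff B _ (s c))))))).
Proof.
move=> hA hB c dc; rewrite -cmorP.
have ir : i _ (r (cdiff B _ (s c))) = cdiff B _ (s c).
  by rewrite rK // cmorP sK.
have dr : cdiff A _ (r (cdiff B _ (s c))) = 0.
  by apply: i_inj; rewrite cmorP ir cdiff0 linear0.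
rewrite hB; first by rewrite linearB /= pi0 sK subr0.
by rewrite linearB /= -cmorP hA // ir subrr.
Qed.

(** Subtracting the boundary of a lift of [uC (p b)] moves the cycle [b] into the image of [i],
    where [uA] applies. *)
Lemma splits_cycles_mid n (uA : A (n + 1) -> A n) (uC : C (n + 1) -> C n) :
  splits_cycles uA -> splits_cycles uC ->
  splits_cycles (fun b => s (uC (p _ b)) +
    i n (uA (r (b - cdiff B n (s (uC (p _ b))))))).
Proof.
move=> hA hC b db; set b' := s _; set e := b - _.
have ir : i _ (r e) = e.
  by rewrite rK // /e linearB /= cmorP sK hC ?subrr // -cmorP db linear0.
have dr : cdiff A _ (r e) = 0.
  by apply: i_inj; rewrite cmorP ir /e linearB /= db cdiff0 subrr linear0.
by rewrite linearD /= -cmorP hA // ir [LHS]addrC subrK.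
Qed.

(** [uB (i a)] has boundary [i a] but need not come from [A]. Its image in [C] is a cycle, hence a
    boundary; subtracting the boundary of a lift brings it into the image of [i] and leaves its
    differential unchanged. *)
Lemma splits_cycles_sub n (uB : B (n + 1 + 1) -> B (n + 1)) (uC : C (n + 1) -> C n) :
  splits_cycles uB -> splits_cycles uC ->
  splits_cycles (fun a =>
    r (uB (i _ a) - cdiff B n (s (uC (p _ (uB (i _ a))))))).
Proof.
move=> hB hC a da; apply: i_inj; rewrite cmorP.
have dB : cdiff B _ (uB (i _ a)) = i _ a by rewrite hB // -cmorP da linear0.
rewrite rK; first by rewrite linearB /= cdiff0 subr0.
by rewrite linearB /= cmorP sK hC ?subrr // -cmorP dB pi0.
Qed.

End TwoOfThree.

Definition two_of_three (P Q S : Prop) : Prop :=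
  [/\ P -> Q -> S, P -> S -> Q & Q -> S -> P].


Lemma exact_two_of_three (A B C : cochain R) (i : cmap A B) (p : cmap B C) :
  short_exact_cochain i p ->
  two_of_three (exact_cochain A) (exact_cochain B) (exact_cochain C).
Proof.
move=> ip.
have sP n : {s : C n -> B n | cancel s (p n)}.
  by have [_ _ /choice[s sP]] := ip n; exists s.
have rP n : {r : B n -> A n | forall b, p n b = 0 -> i n (r b) = b}.
  apply: boolp.cid; have [_ ker _] := ip n.
  have /choice[r rP] b : exists a, p n b = 0 -> i n a = b.
    case: (pselect (p n b = 0)) => [/ker[a ->]|nb]; first by exists a.
    by exists 0.
  by exists r.
pose s n := proj1_sig (sP n); pose r n := proj1_sig (rP n).
have sK n : cancel (s n) (p n) := proj2_sig (sP n).
have rK n : forall b, p n b = 0 -> i n (r n b) = b := proj2_sig (rP n).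
split=> /exactP uP /exactP vP; apply/exactP => n.
- have [u uS] := uP (n + 1); have [v vS] := vP n; eexists.
  exact: (splits_cycles_quo ip rK sK uS vS).
- have [u uS] := uP n; have [v vS] := vP n; eexists.
  exact: (splits_cycles_mid ip rK sK uS vS).
(* [splits_cycles_sub] uses [C] one degree below the cycles that it splits in [A]; rewriting [n] as
   a successor avoids a cast. *)
- have [m ->] := int_succ n.
  have [u uS] := uP (m + 1); have [v vS] := vP m; eexists.
  exact: (splits_cycles_sub ip rK sK uS vS).
Qed.

(** [b - s (p b)] lies in the kernel of [p], and its unique preimage under [i] depends linearly on
    [b]. *)
Lemma split_exact_retraction (A B C : lmodType R)
    (i : {linear A -> B}) (p : {linear B -> C}) :
  split_exact i p ->
  exists r : {linear B -> A},
    cancel i r /\ forall b, p b = 0 -> i (r b) = b.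
Proof.
move=> [[inj ker _] [s sK]].
have /choice[r rP] b : exists a, i a = b - s (p b).
  by have [] := ker (b - s (p b)) => - [|a ->]; [rewrite linearB /= sK subrr|exists a].
have [F FE] : exists F : {linear B -> A}, F =1 r.
  apply: linear_fun_exists => c x y; apply: inj.
  by rewrite linearP /= !rP !linearP /= scalerDr addrACA.
exists F; split=> [a|b pb]; rewrite FE; last by rewrite rP pb linear0 subr0.
have pi0 : p (i a) = 0 by apply/ker; exists a.
by apply: inj; rewrite rP pi0 linear0 subr0.
Qed.

(** Each witness is the formula of the corresponding chase, assembled from linear maps; the
    splittings supply linear [s] and [r]. *)
Lemma contractible_two_of_three (A B C : cochain R) (i : cmap A B) (p : cmap B C) :
  (forall n, split_exact (i n) (p n)) ->
  two_of_three (contractible A) (contractible B) (contractible C).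
Proof.
move=> spl; have ip : short_exact_cochain i p by move=> n; case: (spl n).
have sP n : {s : {linear C n -> B n} | cancel s (p n)}.
  by apply: boolp.cid; case: (spl n).
have rP n := boolp.cid (split_exact_retraction (spl n)).
pose s n := proj1_sig (sP n); pose r n := proj1_sig (rP n).
have sK n : cancel (s n) (p n) := proj2_sig (sP n).
have rK n : forall b, p n b = 0 -> i n (r n b) = b by case: (proj2_sig (rP n)).
split=> /contractibleP uP /contractibleP vP; apply/contractibleP => n.
- have [u uS] := uP (n + 1); have [v vS] := vP n.
  exists (p n \o (v \o (s (n + 1) \-
    (i (n + 1) \o (u \o (r _ \o (cdiff B _ \o s _)))))) : {linear _ -> _}).
  exact: (splits_cycles_quo ip rK sK uS vS).
- have [u uS] := uP n; have [v vS] := vP n.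
  pose f := s n \o (v \o p (n + 1)) : {linear _ -> _}.
  exists (f \+ (i n \o (u \o (r _ \o (idfun \- (cdiff B n \o f)))))
    : {linear _ -> _}).
  exact: (splits_cycles_mid ip rK sK uS vS).
- have [m ->] := int_succ n.
  have [u uS] := uP (m + 1); have [v vS] := vP m.
  pose f := u \o i (m + 1 + 1) : {linear _ -> _}.
  exists (r (m + 1) \o (f \- (cdiff B m \o (s m \o (v \o (p (m + 1) \o f)))))
    : {linear _ -> _}).
  exact: (splits_cycles_sub ip rK sK uS vS).
Qed.

End Contraction.

(** * Shifts and the cone of the identity *)

Section PairLinear.
Variables (R : pzRingType) (M N P : lmodType R).
Variables (f : {linear M -> N}) (g : {linear M -> P}).

Definition pair_lin (x : M) : N * P := (f x, g x).

Fact pair_lin_linear : linear pair_lin.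
Proof. by move=> c x y; rewrite /pair_lin !linearP. Qed.
HB.instance Definition _ :=
  GRing.isLinear.Build R M (N * P)%type _ pair_lin pair_lin_linear.

End PairLinear.

Section Cone.
Variables (R : pzRingType) (X : cochain R).

Definition shift : cochain R.
Proof.
exists (fun n => X (n + 1)) (fun n => \- cdiff X (n + 1) : {linear _ -> _}).
by abstract by move=> n x /=; rewrite linearN /= cdiff0 !oppr0.
Defined.

(* the cone of the identity of X *)
Definition cone : cochain R.
Proof.
exists (fun n => (X n * X (n + 1)%R)%type : lmodType R)
  (fun n => pair_lin (cdiff X n \o fst \+ snd) (\- (cdiff X (n + 1) \o snd))
    : {linear _ -> _}).
abstract by move=> n [x y]; rewrite /= /pair_lin /= linearD /= cdiff0 add0r subrr
  linearN /= cdiff0 !oppr0.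
Defined.

Definition cone_in : cmap X cone.
Proof.
exists (fun n => pair_lin idfun \0 : {linear X n -> cone n}).
by abstract by move=> n x; rewrite /= /pair_lin /= linear0 oppr0 addr0.
Defined.

Definition cone_out : cmap cone shift.
Proof. by exists (fun n => snd : {linear cone n -> shift n}). Defined.

Lemma cone_contractible : contractible cone.
Proof.
exists (fun n => pair_lin \0 fst : {linear cone (n + 1) -> cone n}).
move=> n [x y]; rewrite /= /pair_lin /= linear0 add0r.
by rewrite -[RHS]/(_ + _, _ + _) /= addr0 addKr.
Qed.

Lemma cone_short_exact : short_exact_cochain cone_in cone_out.
Proof.
move=> n; split=> [x y [] //|[x y]|y]; last by exists (0, y).
by split=> /= [->|[a [_ ->]]] //; exists x.
Qed.

End Cone.

(* [cterm X] takes propositionally equal degrees to distinct types. *)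
Section Cast.
Variables (R : pzRingType) (X : cochain R).

Definition degree_cast m n (e : m = n) : {linear X m -> X n} :=
  match e in _ = n return {linear X m -> X n} with erefl => idfun end.

(** Equality proofs between integers are unique ([eq_axiomK]), so a cast depends only on its
    endpoints. *)
Lemma degree_castM l m n (e1 : l = m) (e2 : m = n) (e3 : l = n) x :
  degree_cast e2 (degree_cast e1 x) = degree_cast e3 x.
Proof. by case: m / e1 e2 => e2; case: n / e2 e3 => e3; rewrite (eq_axiomK e3). Qed.

Lemma degree_castK m n (e : m = n) : cancel (degree_cast e) (degree_cast (esym e)).
Proof. by case: n / e. Qed.

Lemma cdiff_cast m n (e : m = n) (e' : m + 1 = n + 1) x :
  cdiff X n (degree_cast e x) = degree_cast e' (cdiff X m x).
Proof. by case: n / e e' => e'; rewrite (eq_axiomK e'). Qed.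

(** The differential of [X] ends in degree [n - 1 + 1], whereas the new complex needs [n + 1 - 1];
    the cast bridges the two. *)
Definition unshift : cochain R.
Proof.
exists (fun n => X (n - 1))
  (fun n => \- (degree_cast (addrAC n (- 1) 1) \o cdiff X (n - 1))
    : {linear _ -> _}).
abstract by move=> n x; rewrite /= linearN /= linearN /= opprK
  (cdiff_cast _ (congr1 (+%R^~ 1) (addrAC n (- 1) 1))) cdiff0 !linear0.
Defined.

Definition unshift_in : cmap (shift unshift) X.
Proof.
exists (fun n => degree_cast (addrK 1 n) : {linear shift unshift n -> X n}).
abstract by move=> n x; rewrite /= opprK
  (cdiff_cast _ (congr1 (+%R^~ 1) (addrK 1 n))) (degree_castM _ _
    (congr1 (+%R^~ 1) (addrK 1 n))).
Defined.

Lemma unshift_in_bij n : bijective (unshift_in n).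
Proof.
exists (degree_cast (esym (addrK 1 n))); first exact: degree_castK.
by move=> x; rewrite /= -{1}[addrK 1 n]esymK degree_castK.
Qed.

End Cast.

(** * Tensoring with [V]: homotopies and split sequences *)

Section TensorExact.
Variables (k : comPzRingType) (G : finGroupType) (V : lmodType (galg k G)).
Local Notation R := (galg k G).

Lemma tensor_mapD (M N : lmodType R) (f g : {linear M -> N}) x :
  tensor_map V (f \+ g) x = tensor_map V f x + tensor_map V g x.
Proof.
elim/tensor_ind: x => [|x y IHx IHy|v m]; first by rewrite !linear0 addr0.
  by rewrite !linearD /= IHx IHy addrACA.
by rewrite !tensor_map_tens tensDr.
Qed.

Lemma eq_tensor_map (M N : lmodType R) (f g : {linear M -> N}) :
  f =1 g -> tensor_map V f =1 tensor_map V g.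
Proof.
move=> fg; elim/tensor_ind=> [|x y IHx IHy|v m]; first by rewrite !linear0.
  by rewrite !linearD /= IHx IHy.
by rewrite !tensor_map_tens fg.
Qed.

Lemma tensor_map_id (M : lmodType R) x : tensor_map V (idfun : {linear M -> M}) x = x.
Proof.
elim/tensor_ind: x => [|x y IHx IHy|v m]; first by rewrite linear0.
  by rewrite linearD /= IHx IHy.
by rewrite tensor_map_tens.
Qed.

(* The retraction [r] makes [id - (V ⊗ i) r] vanish on the image of [V ⊗ i], so it
   descends along [V ⊗ p] to a section; no flatness of [V] is involved. *)
Lemma tensor_split_exact (A B C : lmodType R) (i : {linear A -> B})
    (p : {linear B -> C}) (r : {linear tensor V B -> tensor V A}) :
  short_exact i p -> cancel (tensor_map V i) r ->
  split_exact (tensor_map V i) (tensor_map V p).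
Proof.
move=> [inj ker sur] rK.
pose e : {linear tensor V B -> tensor V B} := idfun \- (tensor_map V i \o r).
have e_ker v b b' : p b = p b' -> e (tens v b) = e (tens v b').
  move=> /eqP; rewrite -subr_eq0 -linearB => /eqP/ker[a ab].
  rewrite -[b](subrK b') ab tensDr linearD /= -(tensor_map_tens i) /=.
  by rewrite rK subrr add0r.
have [q qK] := choice sur.
have bal : balanced (fun v c => e (tens v (q c))).
  split=> [v v' c|v c c'|x v c]; first by rewrite tensDl linearD.
    by rewrite -linearD -tensDr; apply: e_ker; rewrite linearD /= !qK.
  by rewrite tensZ; apply: e_ker; rewrite linear_kscale !qK.
pose s : tensor V C -> tensor V B := tlift (fun v c => e (tens v (q c))).
have sp x : s (tensor_map V p x) = e x.
  elim/tensor_ind: x => [|x y IHx IHy|v b].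
  - by rewrite linear0 [s 0](tlift0 bal) linear0.
  - by rewrite linearD [s _](tliftD bal) -!/(s _) IHx IHy linearD.
  - by rewrite tensor_map_tens [s _](tlift_tens bal); apply: e_ker; rewrite qK.
have pi0 x : tensor_map V p (tensor_map V i x) = 0.
  rewrite -tensor_map_comp; apply: tensor_map0 => a /=.
  by apply/ker; exists a.
have tsur y : exists x, tensor_map V p x = y.
  elim/tensor_ind: y => [|_ _ [x <-] [y <-]|v c].
  - by exists 0; rewrite linear0.
  - by exists (x + y); rewrite linearD.
  - by exists (tens v (q c)); rewrite tensor_map_tens qK.
split; last first.
  have [s' s'E] : exists s' : {linear tensor V C -> tensor V B}, s' =1 s.
    apply: linear_fun_exists => c x y.
    have [x' <-] := tsur x; have [y' <-] := tsur y.
    by rewrite -linearP !sp linearP.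
  exists s' => y; have [x <-] := tsur y.
  by rewrite s'E sp /= linearB /= pi0 subr0.
split=> // [|x]; first exact: can_inj rK.
split=> [px|[a ->]]; last exact: pi0.
exists (r x); apply/eqP; rewrite -subr_eq0; apply/eqP.
by rewrite -[LHS]/(e x) -sp px [s 0](tlift0 bal).
Qed.

Lemma retraction_split (A B C : lmodType R) (i : {linear A -> B})
    (p : {linear B -> C}) (r : {linear B -> A}) :
  short_exact i p -> cancel i r -> split_exact (tensor_map V i) (tensor_map V p).
Proof.
move=> ip rK; apply: (tensor_split_exact (r := tensor_map V r)) => // x.
by rewrite /= -tensor_map_comp (@eq_tensor_map _ _ _ idfun) ?tensor_map_id.
Qed.

Definition tensor_cmap (X Y : cochain R) (f : cmap X Y) :
  cmap (tensor_cochain V X) (tensor_cochain V Y).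
Proof.
exists (fun n => tensor_map V (f n) : {linear tensor_cochain V X n -> _}).
abstract by move=> n x; rewrite /= -!tensor_map_comp; apply: eq_tensor_map => m /=;
  apply: cmorP.
Defined.

Lemma tensor_contractible (X : cochain R) :
  contractible X -> contractible (tensor_cochain V X).
Proof.
move=> [h hP]; exists (fun n => tensor_map V (h n)) => n x /=.
rewrite -!tensor_map_comp -tensor_mapD -{1}[x]tensor_map_id.
by apply: eq_tensor_map => m; apply: hP.
Qed.

Lemma tensor_contractible_retract (X Y : cochain R) (i : cmap Y X) (p : cmap X Y) :
  homotopic (p \oc i) (cid Y) ->
  contractible (tensor_cochain V X) -> contractible (tensor_cochain V Y).
Proof.
move=> [h hP]; apply: (contractible_retract (i := tensor_cmap i) (p := tensor_cmap p)).
exists (fun n => tensor_map V (h n)) => n x; apply/eqP; rewrite subr_eq; apply/eqP.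
(* The homotopy identity, freed of subtraction, becomes an equality of linear maps to which the
   additive functor [V ⊗ -] applies. *)
have : tensor_map V (p (n + 1) \o i (n + 1)) x = tensor_map V
    ((cdiff Y n \o h n) \+ (h (n + 1) \o cdiff Y (n + 1)) \+ idfun) x.
  by apply: eq_tensor_map => m; rewrite /= -hP subrK.
by rewrite !tensor_mapD tensor_map_id !tensor_map_comp.
Qed.

End TensorExact.

(** * Cokernels of modules and of complexes *)

Section Cokernel.
Variables (R : pzRingType).

Section Module.
Variables (A B : lmodType R) (j : {linear A -> B}).

Definition in_image : {pred B} := fun b => `[< exists a, b = j a >].

Fact in_image_zmod_closed : zmod_closed in_image.
Proof.
split=> [|_ _ /asboolP[a ->] /asboolP[b ->]]; apply/asboolP.
  by exists 0; rewrite linear0.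
by exists (a - b); rewrite linearB.
Qed.
HB.instance Definition _ := GRing.isZmodClosed.Build B in_image in_image_zmod_closed.

Definition coker := Quotient.quot in_image.
HB.instance Definition _ := GRing.Zmodule.on coker.

Definition coker_proj (b : B) : coker := \pi b.

Lemma coker_projK q : coker_proj (generic_quotient.repr q) = q.
Proof. exact: reprK. Qed.

Lemma coker_projP b b' : coker_proj b = coker_proj b' <-> exists a, b - b' = j a.
Proof.
split=> [/eqmodP/asboolP //|ex].
by apply/eqP; rewrite -Quotient.idealrBE; apply/asboolP.
Qed.

(** Scaling acts on a chosen representative; the image of [j] is stable under scaling, so the choice
    does not matter. *)
Definition coker_scale (c : R) (q : coker) : coker :=
  coker_proj (c *: generic_quotient.repr q).

Lemma coker_scaleE c b : coker_scale c (coker_proj b) = coker_proj (c *: b).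
Proof.
apply/coker_projP; rewrite -scalerBr.
have /coker_projP[a ->] := coker_projK (coker_proj b).
by exists (c *: a); rewrite linearZ.
Qed.

Fact coker_projD b b' : coker_proj (b + b') = coker_proj b + coker_proj b'.
Proof. by rewrite /coker_proj !piE. Qed.

Fact coker_scaleA a b q : coker_scale a (coker_scale b q) = coker_scale (a * b) q.
Proof. by rewrite -[q]coker_projK !coker_scaleE scalerA. Qed.
Fact coker_scale1 : left_id 1 coker_scale.
Proof. by move=> q; rewrite -[q]coker_projK coker_scaleE scale1r. Qed.
Fact coker_scaleDr : right_distributive coker_scale +%R.
Proof.
move=> a q q'; rewrite -[q]coker_projK -[q']coker_projK -coker_projD.
by rewrite !coker_scaleE scalerDr coker_projD.
Qed.
Fact coker_scaleDl q : {morph coker_scale^~ q : a b / a + b}.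
Proof.
by move=> a b /=; rewrite -[q]coker_projK !coker_scaleE scalerDl coker_projD.
Qed.
HB.instance Definition _ := GRing.Zmodule_isLmodule.Build R coker
  coker_scaleA coker_scale1 coker_scaleDr coker_scaleDl.

Fact coker_proj_linear : linear coker_proj.
Proof. by move=> c b b'; rewrite coker_projD -coker_scaleE. Qed.
HB.instance Definition _ :=
  GRing.isLinear.Build R B coker _ coker_proj coker_proj_linear.

Lemma coker_short_exact : injective j -> short_exact j coker_proj.
Proof.
move=> inj; split=> // [b|q]; last first.
  by exists (generic_quotient.repr q); apply: coker_projK.
rewrite -[0](linear0 coker_proj); split=> [/coker_projP|ex].
  by rewrite subr0.
by apply/coker_projP; rewrite subr0.
Qed.

End Module.

(** Two preimages of an element of [C] differ by an element of the image of [i], so [f] takes the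
    same value on both. *)
Lemma short_exact_factor (A B C T : lmodType R) (i : {linear A -> B})
    (p : {linear B -> C}) (f : {linear B -> T}) :
  short_exact i p -> (forall a, f (i a) = 0) ->
  exists g : {linear C -> T}, forall b, g (p b) = f b.
Proof.
move=> [_ ker /choice[s sK]] fi.
have fE b b' : p b = p b' -> f b = f b'.
  move=> /eqP; rewrite -subr_eq0 -linearB => /eqP/ker[a ab].
  by rewrite -[b](subrK b') ab linearD fi add0r.
have [g gE] : exists g : {linear C -> T}, g =1 f \o s.
  apply: linear_fun_exists => c x y; rewrite /= -linearP; apply: fE.
  by rewrite linearP !sK.
by exists g => b; rewrite gE; apply: fE; rewrite sK.
Qed.

Lemma short_exact_cochain_factor (A B C T : cochain R) (i : cmap A B)
    (p : cmap B C) (f : cmap B T) :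
  short_exact_cochain i p -> (forall n a, f n (i n a) = 0) ->
  exists g : cmap C T, forall n b, g n (p n b) = f n b.
Proof.
move=> ip fi.
have gP n := boolp.cid (short_exact_factor (ip n) (fi n)).
pose g n := proj1_sig (gP n).
have gE n : forall b, g n (p n b) = f n b := proj2_sig (gP n).
have gM n c : g (n + 1) (cdiff C n c) = cdiff T n (g n c).
  have [_ _ sur] := ip n; have [b <-] := sur c.
  by rewrite -cmorP !gE cmorP.
by exists (CMap gM).
Qed.

(** The differentials of [B] descend by [short_exact_factor]; [d d = 0] is checked on preimages. *)
Lemma coker_cochain (A B : cochain R) (i : cmap A B) :
  (forall n, injective (i n)) ->
  exists (C : cochain R) (p : cmap B C), short_exact_cochain i p.
Proof.
move=> inj; pose p n : {linear B n -> coker (i n)} := @coker_proj _ _ (i n).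
have ip n : short_exact (i n) (p n) by apply: coker_short_exact.
have dP n : {d : {linear coker (i n) -> coker (i (n + 1))} |
    forall b, d (p n b) = p _ (cdiff B n b)}.
  apply: boolp.cid; apply: (short_exact_factor (f := p _ \o cdiff B n) (ip n)).
  move=> a /=; have [_ ker _] := ip (n + 1); apply/ker.
  by exists (cdiff A n a); rewrite cmorP.
pose d n := proj1_sig (dP n).
have dE n : forall b, d n (p n b) = p _ (cdiff B n b) := proj2_sig (dP n).
have d0 n q : d (n + 1) (d n q) = 0.
  have [_ _ sur] := ip n; have [b <-] := sur q.
  by rewrite !dE cdiff0 linear0.
pose C := @Cochain R (fun n => coker (i n)) d d0.
have pM n b : p (n + 1) (cdiff B n b) = cdiff C n (p n b) by rewrite /= dE.
by exists C, (@CMap R B C p pM).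
Qed.

End Cokernel.

(** * Direct sums of complexes *)

Section DirectSum.
Variables (R : pzRingType) (Y I : cochain R).

Definition csum : cochain R.
Proof.
exists (fun n => (Y n * I n)%type : lmodType R)
  (fun n => pair_lin (cdiff Y n \o fst) (cdiff I n \o snd) : {linear _ -> _}).
abstract by move=> n [y z]; rewrite /= /pair_lin /= !cdiff0.
Defined.

Definition csum_inl : cmap Y csum.
Proof.
exists (fun n => pair_lin idfun \0 : {linear Y n -> csum n}).
abstract by move=> n y; rewrite /= /pair_lin /= linear0.
Defined.

Definition csum_inr : cmap I csum.
Proof.
exists (fun n => pair_lin \0 idfun : {linear I n -> csum n}).
abstract by move=> n y; rewrite /= /pair_lin /= linear0.
Defined.

Definition csum_snd : cmap csum I.
Proof. by exists (fun n => snd : {linear csum n -> I n}). Defined.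

Definition csum_pair (X : cochain R) (f : cmap X Y) (g : cmap X I) : cmap X csum.
Proof.
exists (fun n => pair_lin (f n) (g n) : {linear X n -> csum n}).
abstract by move=> n x; rewrite /= /pair_lin /= !cmorP.
Defined.

Definition csum_copair (T : cochain R) (f : cmap Y T) (g : cmap I T) : cmap csum T.
Proof.
exists (fun n => (f n \o fst) \+ (g n \o snd) : {linear csum n -> T n}).
abstract by move=> n [y z]; rewrite /= linearD /= !cmorP.
Defined.

Lemma csum_short_exact : short_exact_cochain csum_inl csum_snd.
Proof.
move=> n; split=> [x y [] //|[y z]|z]; last by exists (0, z).
by split=> /= [->|[a [_ ->]]] //; exists y.
Qed.

End DirectSum.

(** * Membership in the eight categories *)

Section Membership.
Variable R : pzRingType.
Implicit Types X Y Z : cochain R.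

Lemma fin_generated_prod (M N : lmodType R) :
  fin_generated M -> fin_generated N -> fin_generated (M * N)%type.
Proof.
move=> [m [e eP]] [n [e' eP']]; exists (m + n)%N.
exists (fun i => match split i with inl j => (e j, 0) | inr j => (0, e' j) end).
move=> [x y]; have [[c ->] [c' ->]] := (eP x, eP' y).
exists (fun i => match split i with inl j => c j | inr j => c' j end).
pose L : {linear M -> M * N}%type := pair_lin idfun \0.
pose L' : {linear N -> M * N}%type := pair_lin \0 idfun.
rewrite big_split_ord /=; set u := \sum_i _; set v := \sum_i _.
have -> : (u, v) = L u + L' v by rewrite -[RHS]/(u + 0, 0 + v) addr0 add0r.
rewrite !linear_sum; congr (_ + _); apply: eq_bigr => i _.
  by rewrite linearZ /= (unsplitK (inl i)).
by rewrite linearZ /= (unsplitK (inr i)).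
Qed.

Lemma fin_generated_surj (M N : lmodType R) (f : {linear M -> N}) :
  (forall y, exists x, f x = y) -> fin_generated M -> fin_generated N.
Proof.
move=> sur [n [e eP]]; exists n, (f \o e) => y.
have [x <-] := sur y; have [c ->] := eP x; exists c.
by rewrite linear_sum; apply: eq_bigr => i _; rewrite linearZ.
Qed.


(* Degree shifts by at most 1 keep boundedness, so this covers shifts, cones,
   direct sums and quotients at once. *)
Lemma in_cat_surj (C : cpx_cat) (X X' Y : cochain R) (s s' : int -> int) :
  (forall n, n - 1 <= s n <= n + 1) -> (forall n, n - 1 <= s' n <= n + 1) ->
  (forall n, exists q : {linear (X (s n) * X' (s' n))%type -> Y n},
    forall y, exists x, q x = y) ->
  in_cat C X -> in_cat C X' -> in_cat C Y.
Proof.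
move=> sP s'P qP.
have fg : (forall n, fin_generated (X n)) -> (forall n, fin_generated (X' n)) ->
    forall n, fin_generated (Y n).
  move=> fX fX' n; have [q qs] := qP n.
  by apply: fin_generated_surj qs _; apply: fin_generated_prod.
have zero n : (forall x : X (s n), x = 0) -> (forall x : X' (s' n), x = 0) ->
    forall y : Y n, y = 0.
  move=> X0 X'0 y; have [q qs] := qP n; have [[x x'] <-] := qs y.
  by rewrite (X0 x) (X'0 x') -[(0, 0)]/(0 : X (s n) * X' (s' n)) linear0.
have above : is_bounded_above X -> is_bounded_above X' -> is_bounded_above Y.
  (* The extra 1 absorbs the case [s n = n - 1]; for lower bounds it absorbs [s n = n + 1]. *)
  move=> [N NP] [N' NP']; exists (Num.max N N' + 1) => n ltn.
  have := sP n; have := s'P n => h h'.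
  by apply: zero; [apply: NP | apply: NP']; lia.
have below : is_bounded_below X -> is_bounded_below X' -> is_bounded_below Y.
  move=> [N NP] [N' NP']; exists (Num.min N N' - 1) => n ltn.
  have := sP n; have := s'P n => h h'.
  by apply: zero; [apply: NP | apply: NP']; lia.
have bnd b : in_bounds b X -> in_bounds b X' -> in_bounds b Y.
  by case: b => //= -[? ?] [? ?]; split; [apply: above|apply: below].
case: C => b /=; first exact: bnd.
by move=> [fX bX] [fX' bX']; split; [apply: fg | apply: bnd].
Qed.

Lemma shift_in_cat C X : in_cat C X -> in_cat C (shift X).
Proof.
move=> XC; apply: (@in_cat_surj C X X _ (+%R^~ 1) (+%R^~ 1)) => // [n|n|n]; try lia.
by exists fst => y; exists (y, 0).
Qed.

Lemma unshift_in_cat C X : in_cat C X -> in_cat C (unshift X).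
Proof.
move=> XC; apply: (@in_cat_surj C X X _ (fun n => n - 1) (fun n => n - 1));
  rewrite // => n; try lia.
by exists fst => y; exists (y, 0).
Qed.

Lemma cone_in_cat C X : in_cat C X -> in_cat C (cone X).
Proof.
move=> XC; apply: (@in_cat_surj C X X _ id (+%R^~ 1)) => // [n|n|n]; try lia.
by exists idfun => y; exists y.
Qed.

(** This places the cokernel used for pushouts inside [C], where the universal property can be
    tested on it. *)
Lemma csum_quotient_in_cat C X Y Z (p : cmap (csum X Y) Z) :
  (forall n z, exists y, p n y = z) ->
  in_cat C X -> in_cat C Y -> in_cat C Z.
Proof.
move=> sur; apply: (@in_cat_surj C X Y _ id id) => n; try lia.
by exists (p n); apply: sur.
Qed.

End Membership.

(** * Stable morphisms, and properties of complexes that define thick subcategories *)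

Section Thick.
Variables (k : comPzRingType) (G : finGroupType) (V : lmodType (galg k G)).
Variable C : cpx_cat.
Local Notation R := (galg k G).
Local Notation ob := (cob R C).

Lemma retraction_term_split (X Y Z : cochain R) (i : cmap X Y) (p : cmap Y Z)
    (r : forall n, {linear Y n -> X n}) :
  short_exact_cochain i p -> (forall n, cancel (i n) (r n)) -> term_split V i p.
Proof. by move=> ip rK; split=> // n; apply: (retraction_split V (ip n) (rK n)). Qed.

Lemma cone_term_split (X : cochain R) : term_split V (cone_in X) (cone_out X).
Proof.
apply: (retraction_term_split (r := fun n => fst : {linear cone X n -> X n})) => //.
exact: cone_short_exact.
Qed.

(** This is the cone sequence of [unshift X], with its last term replaced by [X] along the
    isomorphism [unshift_in]. *)
Lemma unshift_term_split (X : cochain R) :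
  term_split V (cone_in (unshift X)) (unshift_in X \oc cone_out (unshift X)).
Proof.
pose r n : {linear cone (unshift X) n -> unshift X n} := fst.
apply: (retraction_term_split (r := r)) => // n.
have [inj ker sur] := cone_short_exact (unshift X) n.
have [g gK Kg] := unshift_in_bij X n.
split=> // [b|c]; last by have [b bE] := sur (g c); exists b; rewrite /= bE Kg.
rewrite -ker; split=> [e|/= ->]; last exact: linear0.
by apply: (can_inj gK); rewrite linear0.
Qed.

(* A projective P is a retract of the cone of P[-1], an injective I of that of I. *)
Lemma E_projective_contractible (P : ob) : E_projective V P -> contractible P.
Proof.
move=> proj; have KC : in_cat C (unshift P) by apply: unshift_in_cat; apply: cobP.
have QC := cone_in_cat KC.
have [_ _ /(_ (cid P))[v vP]] := proj (Cob KC) (Cob QC) P _ _ (unshift_term_split P).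
exact: contractible_retract (ceq_homotopic vP) (cone_contractible _).
Qed.

Lemma E_injective_contractible (I : ob) : E_injective V I -> contractible I.
Proof.
move=> inj; have QC := cone_in_cat (cobP I); have SC := shift_in_cat (cobP I).
have [_ _ /(_ (cid I))[v vP]] := inj I (Cob QC) (Cob SC) _ _ (cone_term_split I).
exact: contractible_retract (ceq_homotopic vP) (cone_contractible _).
Qed.

(** The difference [f - g] factors as [b a] through a contractible complex, and any contraction [h]
    of that complex gives the homotopy [b h a]. *)
Lemma stable_eq_homotopic (X Y : ob) (f g : cmap X Y) :
  stable_eq V f g -> homotopic f g.
Proof.
move=> [P [a [b [/E_projective_contractible[h hP] fg]]]].
exists (fun n => b n \o (h n \o a (n + 1)) : {linear _ -> _}) => n x /=.
by rewrite fg /= -cmorP (cmorP a) -linearD /= -hP [LHS]addrC addKr.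
Qed.

(** The conditions range over all complexes of kG-modules, so that auxiliary direct sums can be used
    without proof of membership in [C]. *)
Definition thick_invariant (S : cochain R -> Prop) : Prop :=
  [/\ forall X, contractible X -> S X,
      forall X Y (i : cmap Y X) (p : cmap X Y),
        homotopic (p \oc i) (cid Y) -> S X -> S Y &
      forall X Y Z (i : cmap X Y) (p : cmap Y Z), term_split V i p ->
        two_of_three (S X) (S Y) (S Z)].

Lemma thick_invariant_exact : thick_invariant (@exact_cochain R).
Proof.
split=> [X|X Y i p|X Y Z i p []]; first exact: exact_contractible.
  exact: exact_retract.
by move=> ip _; apply: exact_two_of_three ip.
Qed.

(** Tensoring a [V]-term split sequence gives one that is split in every degree, to which the linear
    chases apply. *)
Lemma thick_invariant_tensor_contractible :
  thick_invariant (fun X => contractible (tensor_cochain V X)).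
Proof.
split=> [X|X Y i p|X Y Z i p [_ spl]]; first exact: tensor_contractible.
  exact: tensor_contractible_retract.
by apply: (contractible_two_of_three (i := tensor_cmap V i) (p := tensor_cmap V p)).
Qed.

(** Combines exactness with contractibility of [V ⊗ X] to cover [A_Vsplit]. *)
Lemma thick_invariantI (S T : cochain R -> Prop) :
  thick_invariant S -> thick_invariant T -> thick_invariant (fun X => S X /\ T X).
Proof.
move=> [S1 S2 S3] [T1 T2 T3]; split=> [X cX|X Y i p ip [SX TX]|X Y Z i p ip].
- by split; [apply: S1 | apply: T1].
- by split; [apply: S2 ip SX | apply: T2 ip TX].
have [S31 S32 S33] := S3 _ _ _ _ _ ip; have [T31 T32 T33] := T3 _ _ _ _ _ ip.
by split=> -[? ?] [? ?]; split; auto.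
Qed.

Section Invariant.
Variables (S : cochain R -> Prop) (invS : thick_invariant S).

(** A stable isomorphism is a homotopy equivalence, so each object is a homotopy retract of the
    other. *)
Lemma invariant_stable_iso (X Y : ob) (f : cmap X Y) :
  stable_iso V f -> S X <-> S Y.
Proof.
case: invS => _ retr _ [g [/stable_eq_homotopic gf /stable_eq_homotopic fg]].
by split; [apply: retr fg | apply: retr gf].
Qed.

(* The universal property only tests against objects of [C], so [U] has to be
   compared with the termwise cokernel of [(- f, i) : X -> Y ⊕ I], which lies in [C]. *)
Lemma invariant_pushout (X Y I W U : ob) (f : cmap X Y) (i : cmap X I)
    (p : cmap I W) (g : cmap Y U) (j : cmap I U) :
  term_split V i p -> contractible I -> is_pushout f i g j ->
  two_of_three (S X) (S Y) (S U).
Proof.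
case: invS => contr retr tot [ip spl] cI [gf univ].
have iso A B (a : cmap A B) (b : cmap B A) :
    a \oc b =c cid B -> b \oc a =c cid A -> S A <-> S B.
  by move=> /ceq_homotopic ab /ceq_homotopic ba; split;
    [apply: retr ab | apply: retr ba].
(* The sign makes [csum_copair g j] vanish on the image of [gap], because [g f = j i]. *)
pose nf : cmap X Y := CMap (cmor := fun n => \- f n : {linear _ -> _})
  (fun n x => ltac:(by rewrite /= linearN /= cmorP)).
pose gap := csum_pair nf i.
have gap_inj n : injective (gap n).
  by have [inj _ _] := ip n; move=> x y [_]; apply: inj.
have [Z [q gq]] := coker_cochain gap_inj.
have q_sur n z : exists y, q n y = z by have [_ _ sur] := gq n.
have gap_split : term_split V gap q.
  split=> // n; have [r [rK _]] := split_exact_retraction (spl n).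
  (* The second component of [gap] is [i], so projecting to [I] and then retracting [V ⊗ i] retracts
     [V ⊗ gap]. *)
  pose r' := r \o tensor_map V (csum_snd Y I n) : {linear _ -> _}.
  by apply: (tensor_split_exact (r := r') (gq n)) => x; rewrite /= -tensor_map_comp rK.
have SY : S Y <-> S (csum Y I).
  have spl0 : term_split V (csum_inl Y I) (csum_snd Y I).
    pose r n : {linear csum Y I n -> Y n} := fst.
    by apply: (retraction_term_split (r := r)) => //; apply: csum_short_exact.
  have [_ hsum hY] := tot _ _ _ _ _ spl0; have SI := contr _ cI.
  by split=> SA; [apply: hsum | apply: hY].
have ZC : in_cat C Z by apply: csum_quotient_in_cat q_sur (cobP Y) (cobP I).
have q_gap n x : q n (gap n x) = 0 by have [_ ker _] := gq n; apply/ker; exists x.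
have qf : (q \oc csum_inl Y I) \oc f =c (q \oc csum_inr Y I) \oc i.
  move=> n x; apply/eqP; rewrite eq_sym -subr_eq0 -(q_gap n x) /= -linearB.
  by rewrite -[X in q n X]/(_ - _, _ - _) /= subr0 sub0r.
(* [c : U -> Z] comes from the pushout property and [c' : Z -> U] from the cokernel property; they
   are shown to be mutually inverse. *)
have [c [cg cj _]] := univ (Cob ZC) _ _ qf.
have [n x|c' c'q] := short_exact_cochain_factor (f := csum_copair g j) gq.
  by rewrite /= linearN /= [g n (f n x)]gf addNr.
have c'c : c' \oc c =c cid U.
  (* Both [c' \oc c] and the identity restrict to [g] on [Y] and to [j] on [I], so uniqueness
     identifies them with [e]. *)
  have [e [_ _ uniq]] := univ U g j gf.
  have cc'E : c' \oc c =c e.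
    apply: uniq => m y /=; first by rewrite [c m _]cg /= c'q /= linear0 addr0.
    by rewrite [c m _]cj /= c'q /= linear0 add0r.
  have idE : cid U =c e by apply: uniq.
  by move=> n x; rewrite cc'E -[RHS]/(cid U n x) idE.
have cc' : c \oc c' =c cid Z.
  move=> n z; have [[y w] <-] := q_sur n z.
  rewrite /= c'q /= linearD [c n _]cg [c n (j n w)]cj /= -linearD.
  by rewrite -[X in q n X]/(_ + _, _ + _) /= addr0 add0r.
have [ZU UZ] : S Z <-> S U := iso _ _ _ _ c'c cc'.
have [h1 h2 h3] := tot _ _ _ _ _ gap_split.
by case: SY => YB BY; split; auto.
Qed.

Theorem invariant_thick : thick V (fun X : ob => S X).
Proof.
case: (invS) => contr retr tot.
have SI (X : ob) (w : cosyzygy V X) : S (cs_inj w).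
  exact/contr/E_injective_contractible/cs_injective.
split.
- move=> X /stable_eq_homotopic[h hP]; apply: contr; exists h => n x.
  by rewrite -hP /= subr0.
- move=> X w; have [h1 _ h3] := tot _ _ _ _ _ (cs_split w).
  by split=> SX; [apply: h1 | apply: h3].
- move=> X Y Z w f g h [X' [Y' [Z' [w' [f' [g' [h' [a [b [c [sa]]]]]]]]]]].
  (* [S] is invariant under the vertical stable isomorphisms, which reduces the claim to the pushout
     of a standard triangle. *)
  move=> [[j [po _ _]] [ia ib ic _] _ _ _].
  have [h1 h2 h3] := invariant_pushout (cs_split w')
    (E_injective_contractible (cs_injective w')) po.
  have [[XX' X'X] [YY' Y'Y]] := (invariant_stable_iso ia, invariant_stable_iso ib).
  by have [ZZ' Z'Z] := invariant_stable_iso ic; split; auto.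
(* [p i] is homotopic to the identity, so [Y] is a homotopy retract of [X]. *)
- move=> X Y Y' [i [p [i' [p' [pi _ _ _ _]]]]].
  exact: retr (stable_eq_homotopic pi).
Qed.

End Invariant.

End Thick.

Theorem proposition5p2 (k : comPzRingType) (G : finGroupType)
    (V : lmodType (galg k G)) (hV : free_finite_rank V) (C : cpx_cat) :
  thick V (fun X : cob (galg k G) C => A_exact X) /\
  thick V (fun X : cob (galg k G) C => A_Vsplit V X).
Proof.
have invE := thick_invariant_exact V.
split; first exact: invariant_thick invE.
exact: invariant_thick (thick_invariantI invE (thick_invariant_tensor_contractible V)).
Qed.
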